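(* For every integer $d\geqslant 2$, the set of biLipschitz equivalence classes of Delone sets in the Euclidean space $\mathbb{E}^d$ has the cardinality of the continuum.
   Context: Let $M$ be a metric space with distance $d_M$; $B_\rho(x)$ and $B_\rho^\circ(x)$ denote respectively the closed and open balls of radius $\rho$ centered at $x$. A set $\mathcal{A}\subset M$ is a Delone set if for some $0<r<R$: (i) $B_r^\circ(x)\cap B_r^\circ(y)=\varnothing$ for all distinct $x,y\in\mathcal{A}$; (ii) $\bigcup_{x\in\mathcal{A}}B_R(x)=M$. Two Delone sets $\mathcal{A}\subset M_1$ and $\mathcal{B}\subset M_2$ are biLipschitz equivalent if there exist a real $\lambda\geqslant 1$ and a bijection $F:\mathcal{A}\to\mathcal{B}$ such that $\frac1\lambda d_{M_1}(x,y)\leqslant d_{M_2}(F(x),F(y))\leqslant\lambda d_{M_1}(x,y)$ for all $x,y\in\mathcal{A}$. The biLipschitz classes in $\mathbb{E}^d$ are the equivalence classes of this relation on the collection of all Delone sets in $\mathbb{E}^d$ (with the Euclidean metric). *)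

(* Defs.v *)
From HB Require Import structures.
From mathcomp Require Import all_boot all_order all_algebra.
From mathcomp Require Import all_classical all_reals all_analysis.
From mathcomp Require Import ring lra.

Set Implicit Arguments.
Unset Strict Implicit.
Unset Printing Implicit Defensive.

Import Order.TTheory GRing.Theory Num.Theory.
Local Open Scope classical_set_scope.
Local Open Scope ring_scope.

(* The topology carried by 'rV[R]_d comes from the sup norm, so the Euclidean *)
(* distance is put on an alias.                                               *)
Definition euclid (R : realType) (d : nat) : Type := 'rV[R]_d.

HB.instance Definition _ (R : realType) (d : nat) :=
  GRing.Lmodule.copy (euclid R d) 'rV[R]_d.
HB.instance Definition _ (R : realType) (d : nat) :=
  isPointed.Build (euclid R d) 0.

Definition euclid_dist (R : realType) (d : nat) (x y : euclid R d) : R :=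
  Num.sqrt (\sum_(i < d) ((x : 'rV[R]_d) 0 i - (y : 'rV[R]_d) 0 i) ^+ 2).

Section euclid_dist_metric.
Variables (R : realType) (d : nat).
Implicit Types x y z : euclid R d.

Let euclid_distxx x : euclid_dist x x = 0.
Proof.
by rewrite /euclid_dist big1 ?sqrtr0// => i _; rewrite subrr expr0n.
Qed.

Let euclid_dist_sym x y : euclid_dist x y = euclid_dist y x.
Proof.
by congr Num.sqrt; apply: eq_bigr => i _; rewrite -sqrrN opprB.
Qed.

Let euclid_dist_positivity x y : euclid_dist x y = 0 -> x = y.
Proof.
move=> /eqP; rewrite sqrtr_eq0 => le0.
have ge0 (i : 'I_d) : true ->
  0 <= ((x : 'rV[R]_d) 0 i - (y : 'rV[R]_d) 0 i) ^+ 2 by rewrite sqr_ge0.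
have /eqP : \sum_(i < d) ((x : 'rV[R]_d) 0 i - (y : 'rV[R]_d) 0 i) ^+ 2 = 0.
  by apply/eqP; rewrite eq_le le0 sumr_ge0.
rewrite psumr_eq0// => /allP xy; apply/rowP => i.
have := xy i (mem_index_enum _).
by rewrite sqrf_eq0 subr_eq0 => /eqP.
Qed.

Let cauchy_schwarz (a b : 'I_d -> R) :
  (\sum_i a i * b i) ^+ 2 <= (\sum_i a i ^+ 2) * (\sum_i b i ^+ 2).
Proof.
have : 0 <= \sum_i \sum_j (a i * b j - a j * b i) ^+ 2.
  by apply: sumr_ge0 => i _; apply: sumr_ge0 => j _; exact: sqr_ge0.
have -> : \sum_i \sum_j (a i * b j - a j * b i) ^+ 2 =
    \sum_i \sum_j (a i ^+ 2 * b j ^+ 2)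
  + \sum_i \sum_j (b i ^+ 2 * a j ^+ 2)
  - (\sum_i \sum_j ((a i * b i) * (a j * b j))) *+ 2.
  rewrite -sumrMnl -!big_split/= -sumrB; apply: eq_bigr => i _.
  rewrite -sumrMnl -!big_split/= -sumrB; apply: eq_bigr => j _.
  by ring.
by rewrite -!big_distrlr/= -expr2; lra.
Qed.

Let euclid_dist_triangle y x z : euclid_dist x z <= euclid_dist x y + euclid_dist y z.
Proof.
pose a i := (x : 'rV[R]_d) 0 i - (y : 'rV[R]_d) 0 i.
pose b i := (y : 'rV[R]_d) 0 i - (z : 'rV[R]_d) 0 i.
rewrite -(@ler_pXn2r _ 2)// ?nnegrE ?addr_ge0 ?sqrtr_ge0//.
rewrite sqrrD !sqr_sqrtr ?sumr_ge0// => [|i _|i _|i _]; try exact: sqr_ge0.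
have -> : \sum_(i < d) ((x : 'rV[R]_d) 0 i - (z : 'rV[R]_d) 0 i) ^+ 2 =
    \sum_i a i ^+ 2 + (\sum_i a i * b i) *+ 2 + \sum_i b i ^+ 2.
  rewrite -sumrMnl -!big_split/=; apply: eq_bigr => i _.
  by rewrite /a /b; ring.
rewrite lerD2r lerD2l lerMn2r/= (le_trans (ler_norm _))//.
rewrite -sqrtr_sqr -sqrtrM ?sumr_ge0// => [|i _]; last exact: sqr_ge0.
by rewrite ler_wsqrtr// cauchy_schwarz.
Qed.

HB.instance Definition _ := isMetric.Build R (euclid R d)
  euclid_distxx euclid_dist_positivity euclid_dist_sym euclid_dist_triangle.

End euclid_dist_metric.

(* The library's [closed_ball] is the closure of the open ball, which in a    *)
(* general metric space may be smaller than the closed ball.                  *)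
Definition cball (R : realType) (M : metricType R) (x : M) (rho : R) : set M :=
  [set y | mdist x y <= rho].

Definition delone (R : realType) (M : metricType R) (A : set M) : Prop :=
  exists r s : R, [/\ 0 < r, r < s,
    forall x y, A x -> A y -> x <> y -> ball x r `&` ball y r = set0 &
    \bigcup_(x in A) cball x s = [set: M]].

Definition bilipschitz (R : realType) (M1 M2 : metricType R)
    (A : set M1) (B : set M2) : Prop :=
  exists2 lambda : R, 1 <= lambda &
  exists2 F : M1 -> M2, set_bij A B F &
  forall x y, A x -> A y ->
    lambda^-1 * mdist x y <= mdist (F x) (F y) <= lambda * mdist x y.

Definition bilipschitz_class (R : realType) (M : metricType R) (A : set M) :
    set (set M) :=
  [set B | delone B /\ bilipschitz A B].

Definition bilipschitz_classes (R : realType) (M : metricType R) :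
    set (set (set M)) :=
  [set bilipschitz_class A | A in @delone R M].
Arguments bilipschitz_classes {R} M.

(* Main.v *)
Require Import Defs.
From mathcomp Require Import all_boot all_order all_algebra.
From mathcomp Require Import all_classical all_reals all_analysis.
From mathcomp Require Import ring lra zify.
Local Open Scope classical_set_scope.
Local Open Scope card_scope.

Set Implicit Arguments.
Unset Strict Implicit.
Unset Printing Implicit Defensive.
Import Order.TTheory GRing.Theory Num.Theory.

(** There are at most continuum many classes because a Delone set is determined
    by the rational balls that it meets ([meets_sub]), so that Delone sets embed
    into bit sequences, and those into the reals ([ternary_inj]).

    For the lower bound, sets [delone_of s] of integer points are built from bit
    sequences [s] so that a bilipschitz bijection from [delone_of s] to
    [delone_of t] forces [s k -> t k] from some index on
    ([bilipschitz_delone_of]). Real numbers are coded by sequences that repeat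
    every bit infinitely often ([cut_bits]), hence distinct reals give sets
    that are not equivalent in both directions, and so distinct classes.

    The set [delone_of s] is the integer lattice with some points removed inside
    boxes, the [k]-th of which is used when [s k] holds. The distances of the
    boxes to the origin grow so fast that a bilipschitz map with constant [k + 1]
    sends the [k]-th box far away from every box other than the [k]-th. If that
    box is used in the source and not in the target, the map sends it into a
    region where the target is the full lattice. The pattern of removed points
    is chosen to make this impossible ([rigid_pattern]).

    Such patterns are a discrete form of the construction by Burago and Kleiner,
    and by McMullen, of a density that is not the Jacobian of a bilipschitz map.
    Consider a row of equal cubes, alternately full and half-empty, inside a
    longer row. If the map stretches the long edge of the row by nearly as much
    as it can stretch any short edge inside, then the short edges have nearly
    parallel images of nearly equal lengths. On some full cube the map then
    nearly commutes with a translation to the next, half-empty, cube. Since the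
    target is a full lattice, one can translate in the target by an exact integer
    vector and pull back, which injects the points of the full cube, apart from
    those near its boundary, into the points of the half-empty one. Counting
    refutes this ([core_dense_overflow]). Therefore the stretching factor of long
    edges is smaller, by a fixed amount, than the one of short edges
    ([stretch_refine]), provided that the short edges carry in turn a finer
    pattern, confined to thin layers so that the count is not disturbed. Finitely
    many scales bring the factor from [2 L] down to [1 / L], below which no map
    with constant [L] can go ([level]). *)

(** * Counting lattice points of cubes *)

(** The patterns below depend on these two coordinates only: the checkerboard
    alternates along the first, and the second separates the layers reserved
    for the finer pattern. *)
Definition ax0 {n} : 'I_n.+2 := @Ordinal n.+2 0 isT.
Definition ax1 {n} : 'I_n.+2 := @Ordinal n.+2 1 isT.

Lemma sum_modn (F : nat -> nat) M l :
  \sum_(0 <= i < M * l) F (i %% l) = M * \sum_(0 <= i < l) F i.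
Proof.
elim: M => [|M IH]; first by rewrite big_geq.
rewrite mulSn addnC (@big_cat_nat _ _ _ (M * l)) ?leq_addr//= IH mulSnr.
congr (_ + _).
rewrite -{1}[M * l]add0n big_addn addKn.
by apply: eq_big_nat => i /andP[_ il]; rewrite addnC modnMDl modn_small.
Qed.

Lemma sum_nat_itv a b s : a <= b <= s -> \sum_(0 <= i < s) (a <= i < b) = b - a.
Proof.
move=> /andP[ab bs].
rewrite (@big_cat_nat _ _ _ a) ?(leq_trans ab bs)// (@big_cat_nat _ _ _ b a)//=.
rewrite big_nat big1 => [|i /andP[_ ia]]; last by rewrite leqNgt ia.
rewrite (_ : \sum_(b <= i < s) _ = 0); last first.
  by rewrite big_nat big1// => i /andP[bi _]; rewrite [i < b]ltnNge bi andbF.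
rewrite (eq_big_nat _ _ (F2 := fun=> 1)) => [|i ->//].
by rewrite sum_nat_const_nat muln1 add0n addn0.
Qed.

Lemma card_ord_pred n (P : pred nat) :
  #|[pred i : 'I_n | P i]| = \sum_(0 <= i < n) P i.
Proof.
rewrite big_mkord -sum1_card big_mkcond.
by apply: eq_bigr => i _; rewrite inE; case: (P i).
Qed.

Lemma card_box d s (P : 'I_d -> pred nat) :
  #|[pred q : {ffun 'I_d -> 'I_s} | [forall j, P j (q j)]]|
  = \prod_(j < d) \sum_(0 <= i < s) P j i.
Proof.
have -> : #|[pred q : {ffun 'I_d -> 'I_s} | [forall j, P j (q j)]]| =
  #|(family (fun j : 'I_d => [pred i : 'I_s | P j i]) : pred {ffun 'I_d -> 'I_s})|.
  by apply: eq_card => q; rewrite !inE.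
rewrite card_family foldrE big_map big_enum/=.
by apply: eq_bigr => j _; rewrite card_ord_pred.
Qed.

Lemma bernoulli_subn d m M :
  2 * m <= M -> M ^ d.+1 <= (M - 2 * m) ^ d.+1 + 2 * m * d.+1 * M ^ d.
Proof.
move=> mM; elim: d => [|d IH]; first by rewrite !expn1 expn0; lia.
rewrite [M ^ d.+2]expnSr (leq_trans (leq_mul IH (leqnn M)))//= mulnDl.
rewrite -[_ * M ^ d * M]mulnA -expnSr.
rewrite [(M - 2 * m) ^ d.+2]expnSr.
have : (M - 2 * m) ^ d.+1 * (2 * m) <= M ^ d.+1 * (2 * m).
  by rewrite leq_mul2r leq_exp2r ?leq_subr ?orbT.
have : (M - 2 * m) ^ d.+1 * M =
  (M - 2 * m) ^ d.+1 * (M - 2 * m) + (M - 2 * m) ^ d.+1 * (2 * m).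
  by rewrite -mulnDr subnK.
nia.
Qed.

(** A cube of side [s = M l] is compared with a translate of it. The factor 8
    in [M] and in [8 h <= l] is what makes the final inequality hold: cutting a
    margin of [m l] on each side costs at most a quarter of the volume, and the
    layers of height [h] at most an eighth. *)
Section count.
Variables (n m h l M s : nat).
Let d := n.+2.
Hypotheses (ME : M = 8 * m * d) (sE : s = M * l).
Hypotheses (m_gt0 : 0 < m) (h8 : 8 * h <= l) (l_gt0 : 0 < l) (l_even : ~~ odd l).
Implicit Types q : {ffun 'I_d -> 'I_s}.

(** Points at distance at least [m l] from the boundary of a full cube, outside
    the layers of the finer pattern; all of them are present. *)
Definition core_dense : {pred {ffun 'I_d -> 'I_s}} :=
  [pred q : {ffun 'I_d -> 'I_s} | [forall j, (m * l <= q j < (M - m) * l) &&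
    ((j == ax1) ==> (h <= q j %% l))]].

(** All points that can be present in a half-empty cube: nothing is assumed
    about the layers of the finer pattern. *)
Definition sparse : {pred {ffun 'I_d -> 'I_s}} :=
  [pred q : {ffun 'I_d -> 'I_s} | (q ax1 %% l < h) || ~~ odd (q ax0)].

Let sum_lt : \sum_(0 <= i < l) (i < h) = h.
Proof.
rewrite -[RHS]subn0 -(@sum_nat_itv 0 h l)//=; first lia.
Qed.

Let sum_ge : \sum_(0 <= i < l) (h <= i) = l - h.
Proof.
rewrite -(@sum_nat_itv h l l) ?leqnn ?andbT; last lia.
by apply: eq_big_nat => i /andP[_ ->]; rewrite andbT.
Qed.

Let prod1 (a b : nat) (j0 : 'I_d) (F : 'I_d -> nat) :
  F j0 = a -> (forall j, j != j0 -> F j = b) -> \prod_(j < d) F j = a * b ^ n.+1.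
Proof.
move=> Fa Fb; rewrite (bigD1 j0)//= Fa; congr (_ * _).
rewrite (eq_bigr (fun=> b))// prod_nat_const.
by rewrite cardC1 card_ord.
Qed.

Lemma card_core_dense :
  #|core_dense| = (M - 2 * m) ^ d * (l - h) * l ^ n.+1.
Proof.
rewrite (@card_box d s (fun j i => (m * l <= i < (M - m) * l) &&
    ((j == ax1) ==> (h <= i %% l)))).
have mM : 2 * m <= M by rewrite ME /d; nia.
have mlM : m * l <= (M - m) * l <= s.
  by rewrite sE !leq_mul2r; apply/andP; split; apply/orP; right; lia.
rewrite (@prod1 ((M - 2 * m) * (l - h)) ((M - 2 * m) * l) ax1).
- by rewrite expnMn [_ ^ d]expnS -[RHS]mulnA [RHS]mulnACA.
- under eq_bigr do rewrite eqxx/=.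
  rewrite (@big_cat_nat _ _ _ (m * l))//=; last by case/andP: mlM; apply: leq_trans.
  rewrite big_nat big1 ?add0n => [|i /andP[_ ia]]; last by rewrite leqNgt ia.
  rewrite (@big_cat_nat _ _ _ ((M - m) * l))//=; try by case/andP: mlM.
  rewrite (_ : \sum_((M - m) * l <= i < s) _ = 0) ?addn0; last first.
    by rewrite big_nat big1// => i /andP[bi _]; rewrite [i < _]ltnNge bi andbF.
  rewrite -{1}[m * l]add0n big_addn -mulnBl.
  have -> : M - m - m = M - 2 * m by lia.
  rewrite -sum_ge -sum_modn; apply: eq_big_nat => i /andP[_ il].
  rewrite leq_addl/= [i + _]addnC modnMDl.
  suff -> : m * l + i < (M - m) * l by [].
  have : (M - m) * l = (M - 2 * m) * l + m * l by rewrite -mulnDl; congr (_ * _); lia.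
  lia.
- move=> j j1; under eq_bigr do rewrite (negbTE j1)/= andbT.
  rewrite sum_nat_itv// -mulnBl; congr (_ * _); lia.
Qed.

Lemma card_sparse :
  #|sparse| <= M ^ d * (l./2 + h) * l ^ n.+1.
Proof.
(* One layer condition per set, so that both are products of intervals. *)
pose Y1 := [pred q : {ffun 'I_d -> 'I_s} | [forall j, (j == ax1) ==> (q j %% l < h)]].
pose Y2 := [pred q : {ffun 'I_d -> 'I_s} | [forall j, (j == ax0) ==> ~~ odd (q j)]].
have -> : #|sparse| = #|[predU Y1 & Y2]|.
  apply: eq_card => q; rewrite !inE; congr (_ || _).
    by apply/idP/forallP => [q1 j|/(_ ax1)]; [apply/implyP => /eqP ->|rewrite eqxx].
  by apply/idP/forallP => [q1 j|/(_ ax0)]; [apply/implyP => /eqP ->|rewrite eqxx].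
have : #|[predU Y1 & Y2]| <= #|Y1| + #|Y2| by rewrite -cardUI leq_addr.
move=> /leq_trans; apply.
rewrite (@card_box d s (fun j i => (j == ax1) ==> (i %% l < h))).
rewrite (@card_box d s (fun j i => (j == ax0) ==> ~~ odd i)).
rewrite (@prod1 (M * h) s ax1); last 2 first.
- by under eq_bigr do rewrite eqxx/=; rewrite -[in RHS]sum_lt -sum_modn -sE.
- move=> j j1; under eq_bigr do rewrite (negbTE j1)/=.
  by rewrite sum_nat_const_nat subn0 muln1.
rewrite (@prod1 (M * l./2) s ax0); last 2 first.
- under eq_bigr do rewrite eqxx/=.
  have s2E : s = (M * l./2) * 2.
    by rewrite sE -{1}[l](odd_double_half l) (negbTE l_even) -muln2 mulnA.
  have := @sum_modn (fun i => (~~ odd i : nat)) (M * l./2) 2.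
  have -> : \sum_(0 <= i < 2) (~~ odd i : nat) = 1 by rewrite unlock.
  rewrite -s2E muln1 => <-.
  by apply: eq_bigr => i _; rewrite modn2 oddb.
- move=> j j1; under eq_bigr do rewrite (negbTE j1)/=.
  by rewrite sum_nat_const_nat subn0 muln1.
rewrite [s in s ^ _]sE expnMn [M ^ d]expnS -mulnDl -mulnDr [h + _]addnC.
by rewrite -[leqRHS]mulnA [leqRHS]mulnACA.
Qed.

(** More than [3/4 * 7/8] of the volume against at most [1/2 + 1/8] of it. *)
Lemma core_dense_overflow : #|sparse| < #|core_dense|.
Proof.
rewrite (leq_ltn_trans card_sparse)// card_core_dense.
rewrite ltn_mul2r expn_gt0 l_gt0/=.
have mM : 2 * m <= M by rewrite ME /d; nia.
have B := @bernoulli_subn n.+1 m M mM.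
have C : 4 * (2 * m * d * M ^ n.+1) = M ^ d.
  by rewrite [M ^ d]expnS ME !mulnA.
have M0 : 0 < M ^ d by rewrite expn_gt0 ME /d; lia.
have l2 : l./2 * 2 = l.
  by rewrite muln2 -{2}[l](odd_double_half l) (negbTE l_even).
move: B C M0; rewrite -/d; set x := M ^ d; set y := (M - 2 * m) ^ d.
set z := _ * M ^ _; clearbody x y z => B C M0.
rewrite -(@ltn_pmul2l 4)// !mulnA.
apply: (@leq_trans (3 * x * (l - h))); last first.
  by rewrite leq_mul2r; apply/orP; right; lia.
by rewrite [4 * _]mulnC [3 * _]mulnC -!mulnA ltn_pmul2l//; lia.
Qed.
End count.
Arguments core_dense : clear implicits.
Arguments sparse : clear implicits.

(** * Euclidean norm *)

Local Open Scope ring_scope.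

Section norm.
Variables (R : realType) (d : nat).
Implicit Types (x y z : 'rV[R]_d).

Definition nrm x : R := Num.sqrt (\sum_(i < d) x 0 i ^+ 2).
Definition dot x y : R := \sum_(i < d) x 0 i * y 0 i.

Lemma mdistE x y : mdist (x : euclid R d) (y : euclid R d) = nrm (x - y).
Proof.
rewrite -[LHS]/(euclid_dist (x : euclid R d) y) /euclid_dist /nrm.
by congr Num.sqrt; apply: eq_bigr => i _; rewrite !mxE.
Qed.

Lemma nrm_ge0 x : 0 <= nrm x.
Proof. exact: sqrtr_ge0. Qed.

Lemma nrm0 : nrm 0 = 0.
Proof. by rewrite /nrm big1 ?sqrtr0// => i _; rewrite mxE expr0n. Qed.

Lemma nrmN x : nrm (- x) = nrm x.
Proof. by congr Num.sqrt; apply: eq_bigr => i _; rewrite mxE sqrrN. Qed.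

Lemma nrmB x y : nrm (x - y) = nrm (y - x).
Proof. by rewrite -nrmN opprB. Qed.

Lemma nrmD x y : nrm (x + y) <= nrm x + nrm y.
Proof.
have := @metric_triangle R (euclid R d) x 0 (- y).
by rewrite !mdistE subr0 (sub0r (- y)) !opprK.
Qed.

Lemma nrm_sqr x : nrm x ^+ 2 = dot x x.
Proof.
by rewrite sqr_sqrtr ?sumr_ge0// => i _; rewrite sqr_ge0.
Qed.

Lemma dotDl x y z : dot (x + y) z = dot x z + dot y z.
Proof. by rewrite -big_split; apply: eq_bigr => i _; rewrite mxE mulrDl. Qed.

Lemma dotZl (a : R) x y : dot (a *: x) y = a * dot x y.
Proof. by rewrite big_distrr; apply: eq_bigr => i _; rewrite mxE/= mulrA. Qed.

Lemma dotC x y : dot x y = dot y x.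
Proof. by apply: eq_bigr => i _; rewrite mulrC. Qed.

Lemma dot_suml (I : Type) (r : seq I) (P : pred I) (F : I -> 'rV[R]_d) y :
  dot (\sum_(i <- r | P i) F i) y = \sum_(i <- r | P i) dot (F i) y.
Proof.
apply: (big_morph (fun x => dot x y)) => [u v|]; first exact: dotDl.
by apply: big1 => i _; rewrite mxE mul0r.
Qed.

Lemma nrm_sum (I : Type) (r : seq I) (P : pred I) (F : I -> 'rV[R]_d) :
  nrm (\sum_(i <- r | P i) F i) <= \sum_(i <- r | P i) nrm (F i).
Proof.
elim/big_rec2: _ => [|i u v _ uv]; first by rewrite nrm0.
by rewrite (le_trans (nrmD _ _))// lerD2l.
Qed.

Lemma nrm_sqrD x y : nrm (x + y) ^+ 2 = nrm x ^+ 2 + dot x y *+ 2 + nrm y ^+ 2.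
Proof. by rewrite !nrm_sqr dotDl 2!(dotC _ (x + y)) !dotDl (dotC y x) addrA; ring. Qed.

Lemma cauchy_schwarz x y : dot x y <= nrm x * nrm y.
Proof.
have : nrm (x + y) ^+ 2 <= (nrm x + nrm y) ^+ 2.
  by rewrite lerXn2r ?nnegrE ?addr_ge0 ?nrm_ge0 ?nrmD.
by rewrite nrm_sqrD sqrrD lerD2r lerD2l lerMn2r.
Qed.

Lemma nrmZ (a : R) x : nrm (a *: x) = `|a| * nrm x.
Proof.
apply/(@pexpIrn _ 2) => //; rewrite ?nnegrE ?mulr_ge0 ?nrm_ge0//.
by rewrite exprMn -normrX (ger0_norm (sqr_ge0 _)) !nrm_sqr dotZl dotC dotZl mulrA expr2.
Qed.

Lemma nrm_eq0 x : nrm x = 0 -> x = 0.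
Proof.
move=> x0; apply: (@mdist_positivity R (euclid R d)).
by rewrite mdistE subr0.
Qed.

Lemma nrm_ge_coord x i : `|x 0 i| <= nrm x.
Proof.
rewrite -sqrtr_sqr ler_wsqrtr// (bigD1 i)//= lerDl sumr_ge0// => j _.
exact: sqr_ge0.
Qed.

Lemma nrm_le_coord x (c : R) : (forall i, `|x 0 i| <= c) -> nrm x <= d%:R * c.
Proof.
move=> xc.
have -> : x = \sum_i x 0 i *: (delta_mx 0 i : 'rV[R]_d) by exact: row_sum_delta.
rewrite (le_trans (nrm_sum _ _ _))//.
rewrite mulr_natl -[leRHS](_ : \sum_(i < d) c = _); last first.
  by rewrite sumr_const card_ord.
apply: ler_sum => i _; rewrite nrmZ.
suff -> : nrm (delta_mx 0 i : 'rV[R]_d) = 1 by rewrite mulr1.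
rewrite /nrm (bigD1 i)//= big1 => [|j ji].
  by rewrite mxE !eqxx/= addr0 expr1n sqrtr1.
by rewrite mxE (negbTE ji) andbF expr0n.
Qed.

(** Strict convexity of the Euclidean ball, quantitatively: a vector that is
    nearly as long as allowed in the direction [v] has no room left for a
    transverse component. *)
Lemma near_direction u v (b t : R) : 0 <= b -> nrm v = 1 -> nrm u <= b ->
  b - t <= dot u v -> nrm (u - b *: v) ^+ 2 <= b * t *+ 2.
Proof.
move=> b0 v1 ub ut.
rewrite nrm_sqrD nrmN nrmZ v1 mulr1 dotC -scaleNr dotZl dotC (ger0_norm b0).
have : nrm u ^+ 2 <= b ^+ 2 by rewrite lerXn2r ?nnegrE ?nrm_ge0.
have : b * (b - t) <= b * dot u v by rewrite ler_wpM2l.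
nra.
Qed.
End norm.

(** * Integer points *)

Section lattice.
Variables (R : realType) (d : nat).
Implicit Types x y z : 'rV[int]_d.

Definition emb x : 'rV[R]_d := map_mx intr x.

Lemma embB x y : emb (x - y) = emb x - emb y.
Proof. exact: map_mxB. Qed.

Lemma embD x y : emb (x + y) = emb x + emb y.
Proof. exact: map_mxD. Qed.

Lemma emb_le_coord x (c : nat) : (forall i, `|x 0 i| <= c%:Z) ->
  nrm (emb x) <= (d * c)%:R.
Proof.
move=> xc; rewrite natrM; apply: nrm_le_coord => i.
by rewrite mxE -intr_norm pmulrn ler_int.
Qed.

Lemma coord_le_emb x (c : nat) i : nrm (emb x) <= c%:R -> `|x 0 i| <= c%:Z.
Proof.
move=> xc; rewrite -(ler_int R) (le_trans _ xc)//.
by rewrite (le_trans _ (nrm_ge_coord _ i))// mxE intr_norm.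
Qed.

Lemma emb_inj : injective emb.
Proof.
move=> x y xy; apply/rowP => i; move/rowP/(_ i): xy.
by rewrite !mxE => /intr_inj.
Qed.

Lemma emb_approx (z : 'rV[R]_d) : exists x, nrm (emb x - z) <= d%:R.
Proof.
exists (\row_i Num.floor (z 0 i)); rewrite -[leRHS]mulr1.
apply: nrm_le_coord => i; rewrite !mxE distrC ger0_norm ?subr_ge0 ?floor_le//.
by have := floorD1_gt (z 0 i); rewrite intrD lerBlDl => /ltW.
Qed.

Definition off (q : 'I_d -> nat) : 'rV[int]_d := \row_j (q j)%:Z.
End lattice.

(** The even indices are singled out because each of them pairs a full cube with
    the half-empty cube that follows it. *)
Section pigeonhole.
Variables (R : realType) (T : finType) (N : nat) (e : T -> nat -> R) (b c : R).
Hypotheses (N_gt0 : (0 < N)%N) (e_ge0 : forall t j, (j < 2 * N)%N -> 0 <= e t j)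
  (sum_e : forall t, \sum_(0 <= j < 2 * N) e t j <= b)
  (bc : #|T|%:R * b <= N%:R * c).

Lemma even_pigeonhole : exists2 i, (i < N)%N & forall t, e t (2 * i)%N <= c.
Proof.
apply: contrapT => noi.
have big i : (i < N)%N -> c < \sum_t e t (2 * i)%N.
  move=> iN; have /asboolPn/existsp_asboolPn[t /negP] : ~ (forall t, e t (2 * i)%N <= c).
    by move=> et; apply: noi; exists i.
  rewrite -ltNge => ct; rewrite (lt_le_trans ct)// (bigD1 t)//= lerDl.
  by apply: sumr_ge0 => t' _; apply: e_ge0; rewrite ltn_mul2l.
have : N%:R * c < \sum_(0 <= i < N) \sum_t e t (2 * i)%N.
  rewrite mulr_natl -[N in _ *+ N]subn0 -sumr_const_nat.
  by apply: ltr_sum_nat => // i /andP[_ /big].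
rewrite exchange_big/= ltNge => /negP; apply; rewrite (le_trans _ bc)//.
rewrite mulr_natl -sumr_const; apply: ler_sum => t _.
rewrite (le_trans _ (sum_e t))//.
have -> : \sum_(0 <= j < 2 * N) e t j =
    \sum_(0 <= i < N) (e t (2 * i)%N + e t (2 * i).+1).
  elim: (N) => [|k IH]; first by rewrite !big_geq.
  by rewrite mulnSr addn2 !big_nat_recr//= IH addrA.
rewrite !big_nat; apply: ler_sum => i /andP[_ iN].
by rewrite lerDl e_ge0//; lia.
Qed.
End pigeonhole.

(** * One refinement of a pattern *)

Section site.
Variables (R : realType) (n : nat).
Local Notation d := n.+2.
Local Notation Z := 'rV[int]_d.

Definition xshift (t : nat) : Z := off (fun j => if j == ax0 then t else 0%N).

Variables (A : Z -> Prop) (f : Z -> 'rV[R]_d) (W : R).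

(** For a bijection onto a set [B] of integer points this says that [B] contains
    every integer point within [W] of [f x]. It is all that the argument needs
    from surjectivity, and it replaces degree theory. *)
Definition locally_onto (x : Z) : Prop :=
  forall w : Z, nrm (emb R w) <= W -> exists2 y, A y & f y = f x + emb R w.

(** The box with corner [p], of height [h] in the second coordinate and of side
    [l] in the others, carries [pat]. The far end of its long edge lies outside
    the half-open box, hence the separate condition on it. *)
Definition site (pat : nat -> nat -> bool) (l h : nat) (p : Z) : Prop :=
  [/\ A p, A (p + xshift l) &
   forall q : 'I_d -> nat, (forall j, (q j < l)%N) -> (q ax1 < h)%N ->
     (A (p + off q) <-> pat (q ax0) (q ax1)) /\
     (A (p + off q) -> locally_onto (p + off q))].

(** Blocks of length [M l] along the first coordinate are alternately full and
    half-empty; the layers of height [h], one every [l], carry [pat] repeated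
    with period [l]. *)
Definition refine (M l h : nat) (pat : nat -> nat -> bool) (u v : nat) : bool :=
  if (v %% l < h)%N then pat (u %% l)%N (v %% l)%N
  else ~~ odd (u %/ (M * l)) || ~~ odd u.

Definition stretch_lt pat l h (b : R) : Prop :=
  forall p, site pat l h p -> nrm (f (p + xshift l) - f p) < b * l%:R.

(** One step of the induction on scales. If edges of length [l] of the finer
    sites are stretched by less than [b], then edges of length [(2 N + 1) s] of
    the coarser sites are stretched by less than a slightly smaller [a].
    Otherwise the coarse edge is a chain of fine edges which together have
    almost no slack, so most of them are nearly parallel to one vector. On some
    full cube [f] then commutes, up to an error [l], with a translation to the
    next cube; since [f] is locally onto, this injects the core of the full cube
    into the half-empty one, which is too small to receive it.
    [m l] bounds the distance by which a point can miss its translate, [c]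
    bounds the loss of length that is harmless, and [budget] says that the total
    loss over the [N] pairs of cubes leaves one of them with at most [c]. *)
Section step.
Variables (L N l h : nat) (pat : nat -> nat -> bool) (a b c : R).
Variables m M s : nat.
Hypotheses (mE : m = (L * (L * d + 2) + d)%N) (ME : M = (8 * m * d)%N).
Hypothesis sE : s = (M * l)%N.
Hypotheses (L_gt0 : (0 < L)%N) (N_gt0 : (0 < N)%N) (h_gt0 : (0 < h)%N).
Hypotheses (h8 : (8 * h <= l)%N) (dl : (d <= l)%N) (l_even : ~~ odd l).
Hypotheses (pat0 : pat 0%N 0%N).
Hypothesis lip : forall x y, A x -> A y ->
  nrm (f x - f y) <= L%:R * nrm (emb R (x - y)).
Hypothesis colip : forall x y, A x -> A y ->
  nrm (emb R (x - y)) <= L%:R * nrm (f x - f y).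
Hypothesis stretch_b : stretch_lt pat l h b.
Hypotheses (a_gt0 : 0 < a) (b_gt0 : 0 < b) (W_ge : b * s%:R + d%:R <= W).
Hypothesis budget : (M ^ d)%:R * (2 * N%:R * (b - a) + 2 * L%:R * d%:R) <= N%:R * c.
Hypothesis bc : 2 * b * c * M%:R ^+ 2 <= 1.

Variable p : Z.
Hypothesis p_site : site (refine M l h pat) ((2 * N).+1 * s) s p.
Local Notation grid_index := {ffun 'I_d -> 'I_M}.

Let l_gt0 : (0 < l)%N. Proof. lia. Qed.
Let M_ge : (8 <= M)%N. Proof. rewrite ME mE; nia. Qed.
Let s_gt0 : (0 < s)%N. Proof. by rewrite sE muln_gt0 l_gt0 andbT; lia. Qed.

(** The [M ^ d] starting points of the chains, and their successors along the
    first coordinate. *)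
Definition grid (g : grid_index) (t : nat) : Z :=
  p + off (fun j => (l * g j + if j == ax0 then l * t else 0)%N).

Lemma gridS g t : grid g t.+1 = grid g t + xshift l.
Proof.
rewrite /grid -addrA; congr (_ + _); apply/rowP => j; rewrite !mxE.
by case: ifP => _; rewrite ?addn0 ?addr0// mulnS; lia.
Qed.

Let subpattern (g : grid_index) t (q : 'I_d -> nat) :
  (t < 2 * N * M)%N -> (forall j, (q j < l)%N) -> (q ax1 < h)%N ->
  let r := fun j => (l * g j + (if j == ax0 then l * t else 0) + q j)%N in
  [/\ (forall j, (r j < (2 * N).+1 * s)%N), (r ax1 < s)%N &
      refine M l h pat (r ax0) (r ax1) = pat (q ax0) (q ax1)].
Proof.
move=> tN ql qh r.
have gM j : (l * g j + l <= s)%N.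
  by rewrite sE [(M * l)%N]mulnC -mulnSr leq_mul2l ltn_ord orbT.
have tl : (l * t + l <= 2 * N * s)%N.
  by rewrite sE mulnA [(_ * l)%N]mulnC -mulnSr leq_mul2l tN orbT.
have r0 : (r ax0 %% l)%N = q ax0.
  by rewrite /r eqxx -mulnDr mulnC modnMDl modn_small.
have r1 : (r ax1 %% l)%N = q ax1.
  by rewrite /r/= addn0 mulnC modnMDl modn_small.
split.
- move=> j; rewrite /r mulSn; have := gM j; have := ql j.
  by case: ifP => _; lia.
- by rewrite /r/=; have := gM ax1; have := ql ax1; lia.
- by rewrite /refine r1 qh r0.
Qed.

Let subpoint g t q : grid g t + off q =
  p + off (fun j => l * g j + (if j == ax0 then l * t else 0) + q j)%N.
Proof. by rewrite /grid -addrA; congr (_ + _); apply/rowP => j; rewrite !mxE; lia. Qed.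

Lemma grid_in g t : (t <= 2 * N * M)%N -> A (grid g t).
Proof.
case: p_site => _ _ Ap tN.
pose r := fun j : 'I_d => (l * g j + (if j == ax0 then l * t else 0))%N.
have gM j : (l * g j + l <= s)%N.
  by rewrite sE [(M * l)%N]mulnC -mulnSr leq_mul2l ltn_ord orbT.
have tl : (l * t <= 2 * N * s)%N.
  by rewrite sE mulnA [(_ * l)%N]mulnC leq_mul2l tN orbT.
have r1 : (r ax1 < s)%N by rewrite /r/=; have := gM ax1; lia.
have rs j : (r j < (2 * N).+1 * s)%N.
  by rewrite /r mulSn; have := gM j; case: ifP => _; lia.
apply/(Ap r rs r1).1.
have rl0 : (r ax0 %% l = 0)%N by rewrite /r eqxx -mulnDr modnMr.
have rl1 : (r ax1 %% l = 0)%N by rewrite /r/= addn0 modnMr.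
by rewrite /refine rl0 rl1 h_gt0.
Qed.

Lemma grid_site g t : (t < 2 * N * M)%N -> site pat l h (grid g t).
Proof.
move=> tN; split; [exact/grid_in/ltnW|by rewrite -gridS; exact: grid_in|].
move=> q ql qh; case: p_site => _ _ Ap.
have [r1 r2 r3] := subpattern g tN ql qh.
by rewrite subpoint -r3; exact: Ap.
Qed.

Definition edge (g : grid_index) (j : nat) : 'rV[R]_d :=
  f (grid g (j.+1 * M)) - f (grid g (j * M)).

Lemma nrm_edge g j : (j < 2 * N)%N -> nrm (edge g j) <= b * s%:R.
Proof.
move=> jN; rewrite /edge -(telescope_sumr (fun i => f (grid g i))); last first.
  by rewrite mulSn leq_addl.
rewrite (le_trans (nrm_sum _ _ _))//.
have -> : b * s%:R = \sum_(j * M <= i < j.+1 * M) (b * l%:R).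
  by rewrite sumr_const_nat -mulnBl subSnn mul1n -mulrnAr -mulrnA sE mulnC.
rewrite big_nat [leRHS]big_nat; apply: ler_sum => i /andP[_ ij].
rewrite gridS ltW//; apply/stretch_b/grid_site.
rewrite (leq_trans ij)// leq_mul2r jN orbT//.
Qed.

(** Every chain has, up to one cube at each end, the endpoints of the coarse
    edge. *)
Lemma edge_sum v : nrm v = 1 -> forall g,
  dot (f (p + xshift ((2 * N).+1 * s)) - f p) v - 2 * L%:R * (d%:R * s%:R) <=
  \sum_(0 <= j < 2 * N) dot (edge g j) v.
Proof.
move=> v1 g; case: p_site => Ap Ap' _.
have dot_le x : `|dot x v| <= nrm x.
  rewrite ler_norml; apply/andP; split.
    rewrite lerNl -[nrm x]mulr1 -v1 -mulN1r -dotZl scaleN1r -(nrmN x).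
    exact: cauchy_schwarz.
  by rewrite -[nrm x]mulr1 -v1 cauchy_schwarz.
have gs j : (l * g j <= s)%N.
  by rewrite sE [(M * l)%N]mulnC leq_mul2l ltnW ?orbT.
have e0 : nrm (f p - f (grid g 0)) <= L%:R * (d%:R * s%:R).
  rewrite (le_trans (lip _ (grid_in _ _)))// ler_wpM2l// -natrM.
  apply: emb_le_coord => i; rewrite !mxE; have := gs i.
  by clear; case: ifP => _; lia.
have e1 : nrm (f (grid g (2 * N * M)) - f (p + xshift ((2 * N).+1 * s))) <=
    L%:R * (d%:R * s%:R).
  rewrite (le_trans (lip (grid_in _ _) _))// ler_wpM2l// -natrM.
  apply: emb_le_coord => i; rewrite !mxE; have := gs i.
  case: ifP => _; last lia.
  rewrite [(l * (_ * M))%N]mulnC -mulnA -sE mulSn; lia.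
rewrite -dot_suml (telescope_sumr (fun j => f (grid g (j * M))))// mul0n.
set D := _ - f p in e1 *; set u := f p - _ in e0; set w := f (grid g _) - _ in e1.
have -> : f (grid g (2 * N * M)) - f (grid g 0) = D + (w + u).
  by rewrite addrCA [D + u]addrA subrK addrA subrK.
rewrite (dotDl D) (dotDl w).
have := dot_le w; have := dot_le u; rewrite !ler_norml => /andP[? _] /andP[? _].
lra.
Qed.

(** If the coarse edge is stretched by [a], then in some pair of cubes all the
    block edges are close to one vector, by [even_pigeonhole] applied to the
    missing lengths [e] and by [near_direction]. *)
Lemma aligned_block : a * ((2 * N).+1 * s)%:R <=
    nrm (f (p + xshift ((2 * N).+1 * s)) - f p) ->
  exists2 i, (i < N)%N & exists v, nrm v = b * s%:R /\
    forall g, nrm (edge g (2 * i) - v) <= l%:R.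
Proof.
set D := _ - f p => aD.
have D0 : 0 < nrm D by apply: lt_le_trans aD; rewrite mulr_gt0// ltr0n muln_gt0.
pose v := (nrm D)^-1 *: D.
have v1 : nrm v = 1.
  by rewrite nrmZ ger0_norm ?invr_ge0 ?nrm_ge0// mulVf ?gt_eqF.
have Dv : dot D v = nrm D.
  by rewrite dotC dotZl -nrm_sqr expr2 mulKf ?gt_eqF.
pose e (g : grid_index) j := b - dot (edge g j) v / s%:R.
have s0 : 0 < s%:R :> R by rewrite ltr0n.
have eE g j : e g j * s%:R = b * s%:R - dot (edge g j) v.
  by rewrite mulrBl divfK ?gt_eqF.
have [i iN ei] : exists2 i, (i < N)%N & forall g, e g (2 * i)%N <= c.
  apply: (@even_pigeonhole _ _ N e (2 * N%:R * (b - a) + 2 * L%:R * d%:R)) => //.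
  - move=> g j jN; rewrite -(pmulr_lge0 _ s0) eE subr_ge0.
    rewrite (le_trans (cauchy_schwarz _ _))// v1 mulr1; exact: nrm_edge.
  - move=> g; rewrite -(ler_pM2r s0) mulr_suml.
    rewrite (eq_bigr _ (fun j _ => eE g j)).
    rewrite sumrB sumr_const_nat subn0 -[_ *+ (2 * N)]mulr_natl natrM.
    have := edge_sum v1 g; rewrite Dv.
    move: aD; rewrite natrM -[(2 * N).+1]addn1 natrD natrM.
    have : 0 < a * s%:R by rewrite mulr_gt0.
    lra.
  - by rewrite card_ffun !card_ord.
exists i => //; exists ((b * s%:R) *: v); split.
  by rewrite nrmZ v1 mulr1 ger0_norm// mulr_ge0// ltW.
move=> g.
have bs0 : 0 <= b * s%:R by rewrite mulr_ge0// ltW.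
have i2 : (2 * i < 2 * N)%N by rewrite ltn_mul2l.
have cs : b * s%:R - c * s%:R <= dot (edge g (2 * i)) v.
  have := ei g; rewrite -(ler_pM2r s0) eE; lra.
have nd := near_direction bs0 v1 (nrm_edge g i2) cs.
rewrite -(@ler_pXn2r _ 2) ?nnegrE ?nrm_ge0// (le_trans nd)//.
have l0 : 0 <= l%:R ^+ 2 :> R by rewrite sqr_ge0.
move: bc; rewrite sE natrM => /(ler_wpM2r l0); nra.
Qed.

Definition block_point (k : nat) (q : {ffun 'I_d -> 'I_s}) : Z :=
  p + off (fun j => (q j + if j == ax0 then k * s else 0)%N).

Let block_range k (q : {ffun 'I_d -> 'I_s}) : (k <= 2 * N)%N ->
  let r := fun j => (q j + if j == ax0 then k * s else 0)%N in
  (forall j, (r j < (2 * N).+1 * s)%N) /\ (r ax1 < s)%N.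
Proof.
move=> kN r; split; last by rewrite /r/= addn0.
have ks : (k * s <= 2 * N * s)%N by rewrite leq_mul2r kN orbT.
by move=> j; rewrite /r mulSn; have := ltn_ord (q j); case: ifP => _; lia.
Qed.

Let divs k (x : 'I_s) : ((x + k * s) %/ s)%N = k.
Proof. by rewrite addnC divnMDl// divn_small ?addn0. Qed.

Let s_even : odd s = false.
Proof. by rewrite sE oddM (negbTE l_even) andbF. Qed.

Lemma core_dense_in i q : (i < N)%N -> q \in core_dense n m h l M s ->
  A (block_point (2 * i) q).
Proof.
move=> iN /forallP qc; case: p_site => _ _ Ap.
have [|r0 r1] := @block_range (2 * i) q; first by rewrite leq_mul2l ltnW ?orbT.
apply/(Ap _ r0 r1).1; rewrite /refine.
have /andP[_ /= hq] := qc ax1; rewrite /= addn0 ltnNge hq /=.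
by rewrite -sE divs oddM.
Qed.

Lemma in_sparse i q : (i < N)%N -> A (block_point (2 * i).+1 q) ->
  q \in sparse n h l s.
Proof.
move=> iN; case: p_site => _ _ Ap.
have [|r0 r1] := @block_range (2 * i).+1 q; first by rewrite ltn_mul2l iN.
move=> /(Ap _ r0 r1).1; rewrite /refine /= addn0 inE /=.
case: ifP => //= _; rewrite -sE divs /= oddM /=.
by rewrite oddD oddM s_even andbF addbF.
Qed.

(** The preimage of [f x + w], where [w] is an integer vector close to the
    common value of the block edges, lies near the translate of [x]. It is
    within the next cube because [x] is at distance at least [m l] from the
    boundary of its own. *)
Lemma transfer i v w (q : {ffun 'I_d -> 'I_s}) : (i < N)%N ->
  (forall g, nrm (edge g (2 * i) - v) <= l%:R) -> nrm (emb R w - v) <= d%:R ->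
  nrm (emb R w) <= W -> q \in core_dense n m h l M s ->
  exists2 q', q' \in sparse n h l s &
    f (block_point (2 * i).+1 q') = f (block_point (2 * i) q) + emb R w.
Proof.
move=> iN ev wv wW qc; have Aq := core_dense_in iN qc.
have [|r0 r1] := @block_range (2 * i) q; first by rewrite leq_mul2l ltnW ?orbT.
have /(_ w wW)[y Ay fy] : locally_onto (block_point (2 * i) q).
  by case: p_site => _ _ /(_ _ r0 r1)[_]; apply.
have gP j : (q j %/ l < M)%N by rewrite ltn_divLR// -sE.
pose g : grid_index := [ffun j => Ordinal (gP j)].
have gE j : (q j = l * g j + q j %% l :> nat)%N.
  by rewrite ffunE/= mulnC -divn_eq.
have ksl k : (k * s = l * (k * M))%N by rewrite sE mulnA mulnC.
have ql j : (q j %% l < l)%N by rewrite ltn_mod.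
have i2 : (2 * i < 2 * N)%N by rewrite ltn_mul2l.
have Ag : A (grid g (2 * i * M)) by apply: grid_in; rewrite leq_mul2r ltnW ?orbT.
have Ag' : A (grid g ((2 * i).+1 * M)) by apply: grid_in; rewrite leq_mul2r i2 orbT.
(* Route through the grid point below [q], whose block edge is close to [v]. *)
have near_y : nrm (f y - f (grid g ((2 * i).+1 * M))) <= ((L * d + 2) * l)%:R.
  have -> : f y - f (grid g ((2 * i).+1 * M)) =
      (f (block_point (2 * i) q) - f (grid g (2 * i * M))) +
      ((emb R w - v) + (v - edge g (2 * i))).
    by rewrite fy /edge; apply/rowP => j; rewrite !mxE; ring.
  have : nrm (f (block_point (2 * i) q) - f (grid g (2 * i * M))) <= L%:R * (d * l)%:R.
    rewrite (le_trans (lip _ _))// ler_wpM2l//; apply: emb_le_coord => j.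
    rewrite !mxE; have := gE j; have := ql j; rewrite ksl.
    move: (l * g j)%N (q j %% l)%N (l * (2 * i * M))%N (nat_of_ord (q j)) => x r z t.
    by clear; case: ifP => _; lia.
  have := nrmD (f (block_point (2 * i) q) - f (grid g (2 * i * M)))
      ((emb R w - v) + (v - edge g (2 * i))).
  have := nrmD (emb R w - v) (v - edge g (2 * i)).
  have := ev g; rewrite nrmB.
  have : d%:R <= l%:R :> R by rewrite ler_nat.
  rewrite [((L * d + 2) * l)%N]mulnDl natrD -mulnA natrM [(2 * l)%N]mul2n -addnn natrD.
  move: wv; lra.
have yg j : `|(y - grid g ((2 * i).+1 * M)) 0 j| <= (L * ((L * d + 2) * l))%:Z.
  apply: (@coord_le_emb R); rewrite (le_trans (colip _ _))// natrM.
  by rewrite ler_wpM2l.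
have y_off j : exists2 t : 'I_s, true &
    (y 0 j = p 0 j + (t + if j == ax0 then (2 * i).+1 * s else 0)%N%:Z).
  have /forallP/(_ j)/andP[/andP[qlo qhi] _] := qc.
  have := yg j; rewrite !mxE => yj.
  pose t := y 0 j - p 0 j - (if j == ax0 then (2 * i).+1 * s else 0)%N%:Z.
  have tE : `|t - (l * g j)%N%:Z| <= (L * ((L * d + 2) * l))%:Z.
    move: yj; rewrite /t ksl.
    move: (y 0 j) (p 0 j) (l * g j)%N (l * _)%N (L * _)%N => y' p' x z r.
    by clear; case: ifP => _; lia.
  have mlE : (m * l = L * ((L * d + 2) * l) + d * l)%N.
    by rewrite mE mulnDl !mulnA.
  have dl1 : (l <= d * l)%N by rewrite leq_pmull.
  have tb : 0 <= t < s%:Z.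
    have := gE j; have := ql j; move: qlo qhi; rewrite mulnBl -sE mlE.
    move: tE dl1; move: (L * _)%N (d * l)%N (l * g j)%N (q j %% l)%N t => Ll' dl' x r t'.
    by move: (nat_of_ord (q j)) => z; clear; lia.
  have ts : (`|t| < s)%N by move: tb; clear; lia.
  exists (Ordinal ts) => //=; move: tb; rewrite /t.
  move: (y 0 j) (p 0 j) (if _ then _ else _)%N => y' p' z; clear; lia.
have /fin_all_exists2[q' _ q'P] := y_off.
have yE : y = block_point (2 * i).+1 (finfun q').
  by apply/rowP => j; rewrite !mxE ffunE q'P.
exists (finfun q'); last by rewrite -yE.
by apply: (in_sparse iN); rewrite -yE.
Qed.

Lemma stretch_refine : nrm (f (p + xshift ((2 * N).+1 * s)) - f p) <
  a * ((2 * N).+1 * s)%:R.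
Proof.
rewrite ltNge; apply/negP => /aligned_block[i iN [v [v1 ev]]].
have [w wv] := emb_approx v.
have wW : nrm (emb R w) <= W.
  by have := nrmD (emb R w - v) v; rewrite subrK v1; move: wv W_ge; lra.
have /fin_all_exists[F FP] (q : {ffun 'I_d -> 'I_s}) :
    exists q' : {ffun 'I_d -> 'I_s}, q \in core_dense n m h l M s ->
    q' \in sparse n h l s /\
    f (block_point (2 * i).+1 q') = f (block_point (2 * i) q) + emb R w.
  case: (boolP (q \in core_dense n m h l M s)) => [qc|]; last by exists q.
  by have [q' ? ?] := transfer iN ev wv wW qc; exists q'.
have m_gt0 : (0 < m)%N by rewrite mE addn_gt0 orbT.
have := core_dense_overflow ME sE m_gt0 h8 l_gt0 l_even.
rewrite ltnNge => /negP; apply.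
rewrite -(@card_in_imset _ _ F) => [|q q' qc qc' FF].
  by apply/subset_leq_card/fintype.subsetP => _ /imsetP[q qc ->]; have [] := FP q qc.
have : f (block_point (2 * i) q) - f (block_point (2 * i) q') = 0.
  have [_ e] := FP q qc; have [_ e'] := FP q' qc'.
  by move: e; rewrite FF e' => /addIr ->; rewrite subrr.
have := colip (core_dense_in iN qc) (core_dense_in iN qc').
move=> /[swap] ->; rewrite nrm0 mulr0 => le0.
have /nrm_eq0 : nrm (emb R (block_point (2 * i) q - block_point (2 * i) q')) = 0.
  by apply/eqP; rewrite eq_le le0 nrm_ge0.
rewrite embB => /subr0_eq/emb_inj/addrI qq.
apply/ffunP => j; apply/val_inj; move/rowP/(_ j): qq; rewrite !mxE /=.
by move: (q j : nat) (q' j : nat) => x y; clear; lia.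
Qed.

End step.
End site.

(** * Rigid patterns *)

Section rigid.
Variables (R : realType) (n : nat).
Local Notation d := n.+2.
Local Notation Z := 'rV[int]_d.

Definition bilip (A : Z -> Prop) (f : Z -> 'rV[R]_d) (L : nat) : Prop :=
  forall x y, A x -> A y ->
    nrm (f x - f y) <= L%:R * nrm (emb R (x - y)) /\
    nrm (emb R (x - y)) <= L%:R * nrm (f x - f y).

Lemma nrm_xshift t : nrm (emb R (xshift n t)) = t%:R.
Proof.
rewrite /nrm (bigD1 ax0)//= big1 => [|i /negbTE i0]; rewrite !mxE ?eqxx ?i0 ?expr0n//.
by rewrite addr0 sqrtr_sqr ger0_norm.
Qed.

(** Keeping all points whose first coordinate is even makes the final sets
    relatively dense at a fixed scale, however many refinements are used. *)
Record good_shape (pat : nat -> nat -> bool) (l h : nat) : Prop := GoodShape {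
  shape_h : (0 < h)%N; shape_l : (8 * h <= l)%N; shape_d : (d <= l)%N;
  shape_even : ~~ odd l; shape_pat : forall u v, ~~ odd u -> pat u v }.

(** With [c = 1 / (8 L M ^ 2)], lowering the stretching bound by [1 / E] uses one
    half of the budget of a step, and [N = L d E] makes the boundary terms use
    the other half. *)
Section levels.
Variable L : nat.
Hypothesis L_gt0 : (0 < L)%N.
Let m := (L * (L * d + 2) + d)%N.
Let M := (8 * m * d)%N.
Let E := (32 * L * M ^ d.+2)%N.

Let M_gt0 : (0 < M)%N.
Proof. by rewrite /M /m !muln_gt0 /= addn_gt0 orbT. Qed.

Let E_ge : (32 <= E)%N.
Proof. by rewrite /E -mulnA leq_pmulr// muln_gt0 L_gt0 expn_gt0 M_gt0. Qed.

(** The bound starts above the Lipschitz constant, where it is trivial, and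
    never goes below [1 / L], where it contradicts the lower estimate. *)
Definition level_bound (t : nat) : R := Num.max (2 * L%:R - t%:R / E%:R) L%:R^-1.

(** The constant [W] grows with the level because the translation vectors do. *)
Lemma level t : exists pat l h (W : nat), good_shape pat l h /\
  forall A f (W' : R), W%:R <= W' -> bilip A f L ->
    stretch_lt A f W' pat l h (level_bound t).
Proof.
have L0 : 0 < L%:R :> R by rewrite ltr0n.
elim: t => [|t [pat [l [h [W [[h0 h8 dl le pe] IH]]]]]].
  exists (fun _ _ => true), (8 * d)%N, 1%N, 0%N; split.
    split=> //; first lia; first lia.
    by rewrite oddM.
  move=> A f W' _ fL p [Ap Ap' _].
  have [fle _] := fL _ _ Ap' Ap; rewrite (le_lt_trans fle)//.
  rewrite [p + _]addrC addrK nrm_xshift ltr_pM2r ?ltr0n//.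
  by rewrite /level_bound mul0r subr0 lt_max; apply/orP; left; lra.
pose s := (M * l)%N; pose N := (L * d * E)%N.
have N4 : (4 <= N)%N.
  have Ld : (0 < L * d)%N by rewrite muln_gt0 L_gt0.
  by apply: leq_trans (leq_pmull E Ld); apply: leq_trans E_ge.
have s0 : (0 < s)%N by rewrite /s muln_gt0 M_gt0/=; lia.
exists (refine M l h pat), ((2 * N).+1 * s)%N, s, (maxn W (2 * L * s + d)); split.
  split=> //.
  - by rewrite leq_mul2r; apply/orP; right; lia.
  - rewrite mulSn (leq_trans dl)// (leq_trans _ (leq_addr _ _))//.
    by rewrite /s leq_pmull.
  - by rewrite oddM /s oddM (negbTE le) !andbF.
  - move=> u v u2; rewrite /refine; case: ifP => _; last by rewrite u2 orbT.
    apply: pe; move: u2; rewrite {1}(divn_eq u l) oddD oddM (negbTE le) andbF//.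
move=> A f W' WW' fL p psite.
have E0 : 0 < E%:R :> R by rewrite ltr0n; lia.
have M0 : 0 < M%:R :> R by rewrite ltr0n.
have L1 : 1 <= L%:R :> R by rewrite ler1n.
have LV : L%:R^-1 <= L%:R :> R by rewrite (le_trans _ L1)// invf_le1.
have LV0 : 0 < L%:R^-1 :> R by rewrite invr_gt0.
have bb : level_bound t - level_bound t.+1 <= E%:R^-1.
  have EV0 : 0 < E%:R^-1 :> R by rewrite invr_gt0.
  rewrite /level_bound lerBlDr ge_max; apply/andP; split.
    rewrite -lerBlDl le_max; apply/orP; left.
    by rewrite -[t.+1]addn1 natrD mulrDl mul1r; lra.
  rewrite -lerBlDl le_max; apply/orP; right; lra.
have b0 t' : 0 < level_bound t' by rewrite /level_bound lt_max LV0 orbT.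
have b2 : level_bound t <= 2 * L%:R.
  rewrite /level_bound ge_max; apply/andP; split; last lra.
  by rewrite gerBl divr_ge0.
have s0' : 0 < s%:R :> R by rewrite ltr0n.
move: WW'; rewrite natr_max ge_max => /andP[WW' Ws].
pose c : R := (8 * L%:R * M%:R ^+ 2)^-1.
have cE : c * (8 * L%:R * M%:R ^+ 2) = 1.
  by rewrite mulVf// gt_eqF// !mulr_gt0// exprn_gt0.
have c0 : 0 < c by rewrite invr_gt0 !mulr_gt0// exprn_gt0.
apply: (@stretch_refine R n A f W' L N l h pat (level_bound t.+1) (level_bound t)
  c m M s (erefl _) (erefl _) (erefl _) L_gt0 _ h0 h8 dl le _ _ _ _ _ _ _ _ _ p) => //.
- by apply: leq_trans N4.
- exact: pe.
- by move=> x y Ax Ay; have [] := fL _ _ Ax Ay.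
- by move=> x y Ax Ay; have [] := fL _ _ Ax Ay.
- exact: IH.
- rewrite (le_trans _ Ws)// natrD !natrM lerD2r ler_wpM2r//; lra.
- have NE : N%:R = L%:R * d%:R * E%:R :> R.
    by rewrite /N; move: E => E'; rewrite !natrM.
  have EE : E%:R = 32 * L%:R * (M ^ d)%:R * M%:R ^+ 2 :> R.
    have natE x y z : (32 * x * y * (z * z))%N%:R = 32 * x%:R * y%:R * z%:R ^+ 2 :> R.
      by rewrite !natrM; ring.
    by rewrite -natE /E -[d.+2]addn2 expnD mulnA.
  have Ec : E%:R * c = 4 * (M ^ d)%:R.
    have -> : E%:R * c = 4 * (M ^ d)%:R * (c * (8 * L%:R * M%:R ^+ 2)) by rewrite EE; ring.
    by rewrite cE mulr1.
  have Md0 : 0 <= (M ^ d)%:R :> R by [].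
  rewrite mulrDr.
  have h1 : (M ^ d)%:R * (2 * N%:R * (level_bound t - level_bound t.+1)) <=
      N%:R * c / 2.
    rewrite (_ : N%:R * c / 2 = (M ^ d)%:R * (2 * N%:R * E%:R^-1)); last first.
      rewrite -[c](mulKf (lt0r_neq0 E0)) Ec; field.
      exact: lt0r_neq0.
    by rewrite ler_wpM2l// ler_wpM2l// mulr_ge0.
  have h2 : (M ^ d)%:R * (2 * L%:R * d%:R) = N%:R * c / 2.
    by rewrite NE -[_ * E%:R * c]mulrA Ec; field.
  by rewrite h2; lra.
- have : level_bound t * (c * M%:R ^+ 2) <= 2 * L%:R * (c * M%:R ^+ 2).
    by rewrite ler_wpM2r// mulr_ge0 ?exprn_ge0// ltW.
  move: cE; nra.
Qed.

(** After [2 L E] levels the stretching bound is [1 / L], so that no map with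
    bilipschitz constant [L] can be locally onto around such a site. *)
Lemma rigid_pattern : exists pat l h (W : nat), good_shape pat l h /\
  forall A f, bilip A f L -> forall p, ~ site A f W%:R pat l h p.
Proof.
have [pat [l [h [W [shape lt]]]]] := level (2 * L * E).
exists pat, l, h, W; split=> // A f fL p psite.
have := lt A f W%:R (lexx _) fL p psite.
have [Ap Ap' _] := psite; have [_] := fL _ _ Ap' Ap.
rewrite [p + _ - p]addrC addKr nrm_xshift.
have E0 : E%:R != 0 :> R by rewrite pnatr_eq0 -lt0n; lia.
have L0 : 0 < L%:R :> R by rewrite ltr0n.
have -> : level_bound (2 * L * E) = L%:R^-1.
  by rewrite /level_bound natrM mulfK// natrM subrr max_r// invr_ge0 ltW.
by rewrite -(ltr_pM2l L0) mulrA mulfV ?gt_eqF// mul1r => /le_lt_trans/[apply]; rewrite ltxx.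
Qed.
End levels.
End rigid.

(** * Delone sets coding bit sequences *)

Lemma even_round (a : int) : ~~ odd (absz (a + (odd (absz a))%:Z)).
Proof. by case: (boolP (odd (absz a))) => /=; [lia|rewrite addr0]. Qed.

(** A sequence of boxes, the [k]-th of which carries a pattern that is rigid for
    the constant [k + 1]; a bit sequence decides which of the boxes are actually
    marked, and the unmarked ones stay full. *)
Section family.
Variables (R : realType) (n : nat).
Local Notation d := n.+2.
Local Notation Z := 'rV[int]_d.

Record gadget : Type := Gadget {
  gpat : nat -> nat -> bool; glen : nat; ghei : nat; gwid : nat }.

Variable G : nat -> gadget.
Hypothesis G_shape : forall k, good_shape n (gpat (G k)) (glen (G k)) (ghei (G k)).
Hypothesis G_rigid : forall k A (f : Z -> 'rV[R]_d), bilip A f k.+1 ->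
  forall p, ~ site A f (gwid (G k))%:R (gpat (G k)) (glen (G k)) (ghei (G k)) p.

(** Bounds the diameter of the [k]-th box, the translation vectors that occur in
    its analysis and the displacement of the origin that is allowed for. *)
Definition reach k : nat := (k.+1 + gwid (G k) + d * glen (G k))%N.

(** The growth is such that multiplying or dividing the distance of the [k]-th
    box by [k + 1], and then perturbing it by [reach k], never gives the
    distance of another box. *)
Fixpoint center (k : nat) : nat :=
  if k is k'.+1 then (2 * (k'.+3 * (center k' + reach k' + reach k)))%N else 0%N.

Lemma center_even k : ~~ odd (center k).
Proof. by case: k => //= k; rewrite oddM. Qed.

Lemma center_lt m k : (m < k)%N -> (center m + reach m <= center k)%N.
Proof.
elim: k => // k IH; rewrite ltnS leq_eqVlt => /orP[/eqP ->|/IH mk].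
  by rewrite /=; nia.
by rewrite (leq_trans mk)//=; nia.
Qed.

Lemma center_before m k : (m < k)%N ->
  (k.+1 * (center m + d * glen (G m) + gwid (G k) + k) < center k)%N.
Proof.
case: k => // k mk /=.
have : (center m + reach m <= center k + reach k)%N.
  move: mk; rewrite ltnS leq_eqVlt => /orP[/eqP ->//|/center_lt].
  by move=> /leq_trans; apply; exact: leq_addr.
rewrite /reach; move: (d * _)%N (d * _)%N (d * _)%N => x y z.
move: (center m) (center k) (gwid _) (gwid _) (gwid _) => u v a b c.
by clear; nia.
Qed.

Lemma center_after m k : (k < m)%N ->
  (k + k.+1 * (center k + d * glen (G k)) + gwid (G k) < center m)%N.
Proof.
move=> km; have : (center k.+1 <= center m)%N.
  move: km; rewrite leq_eqVlt => /orP[/eqP ->//|/center_lt].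
  by move=> /(leq_trans _); apply; exact: leq_addr.
apply: leq_trans; rewrite /= /reach.
move: (d * _)%N (d * _)%N (center k) (gwid _) (gwid _) => x y u a b.
by clear; nia.
Qed.

Definition in_box k (q : 'I_d -> nat) : Prop :=
  (forall j, q j < glen (G k))%N /\ (q ax1 < ghei (G k))%N.

Definition box_point k (q : 'I_d -> nat) : Z := xshift n (center k) + off q.

Definition pattern_set (s : nat -> bool) (x : Z) : Prop :=
  forall k q, s k -> in_box k q -> x = box_point k q -> gpat (G k) (q ax0) (q ax1).

Lemma box_point0 k q : box_point k q 0 ax0 = (center k + q ax0)%N%:Z.
Proof. by rewrite !mxE. Qed.

Lemma box_point_inj k k' q q' : in_box k q -> in_box k' q' ->
  box_point k q = box_point k' q' -> k = k' /\ q =1 q'.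
Proof.
move=> [qb _] [qb' _] e.
have bound k1 (q1 : 'I_d -> nat) : (q1 ax0 < glen (G k1))%N ->
    (center k1 <= center k1 + q1 ax0 < center k1 + reach k1)%N.
  by rewrite leq_addr ltn_add2l /reach => /leq_trans; apply; nia.
have := bound _ _ (qb ax0); have := bound _ _ (qb' ax0).
have /(congr1 absz) := congr1 (fun x : Z => x 0 ax0) e; rewrite !box_point0 !absz_nat => ->.
move=> /andP[a b] /andP[a' b'].
have kk : k = k'.
  apply/eqP; rewrite eqn_leq; apply/andP; split; rewrite leqNgt; apply/negP => /center_lt.
    lia.
  lia.
split=> // j; have := congr1 (fun x : Z => x 0 j) e; rewrite kk !mxE; lia.
Qed.

Lemma pattern_set_even s (x : Z) : ~~ odd (absz (x 0 ax0)) -> pattern_set s x.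
Proof.
move=> x2 k q _ _ xE; apply: (shape_pat (G_shape k)).
by move: x2; rewrite xE box_point0 absz_nat oddD (negbTE (center_even k)).
Qed.

Lemma nrm_box_point k q : in_box k q ->
  (center k)%:R <= nrm (emb R (box_point k q)) <= (center k + d * glen (G k))%:R.
Proof.
move=> [qb _]; apply/andP; split.
  have := nrm_ge_coord (emb R (box_point k q)) ax0; apply: le_trans.
  rewrite mxE box_point0 ger0_norm//=.
  by rewrite -[leRHS]/((center k + q ax0)%:R) ler_nat leq_addr.
rewrite embD (le_trans (nrmD _ _))// nrm_xshift natrD lerD2l.
by apply: emb_le_coord => j; rewrite mxE; have := qb j; lia.
Qed.

Section rigidity.
Variables (s t : nat -> bool) (f : Z -> 'rV[R]_d) (k : nat).
Hypothesis f_bilip : bilip (pattern_set s) f k.+1.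
Hypothesis f_onto : forall y, pattern_set t y -> exists2 x, pattern_set s x & f x = emb R y.
Hypothesis f_into : forall x, pattern_set s x -> exists2 y, pattern_set t y & f x = emb R y.
Hypothesis f0 : nrm (f 0) <= k%:R.

(** A point of the [k]-th box and its image have comparable distances to the
    origin, and no other box lies at such a distance. *)
Lemma image_avoids_boxes m q q' (w : Z) : in_box k q -> pattern_set s (box_point k q) ->
  nrm (emb R w) <= (gwid (G k))%:R -> in_box m q' ->
  f (box_point k q) + emb R w = emb R (box_point m q') -> m = k.
Proof.
move=> qb sq wW qb' e; apply/eqP/contraT => mk.
have s0 : pattern_set s 0 by apply: pattern_set_even; rewrite mxE.
have := nrm_box_point qb; have := nrm_box_point qb'; rewrite -e.
have [] := f_bilip sq s0; rewrite subr0.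
move: (box_point k q) => x up dn.
have t1 := nrmD (f x) (emb R w).
have t2 := nrmD (f x - f 0) (f 0); rewrite subrK in t2.
have t3 := nrmD (f x + emb R w) (- emb R w); rewrite addrK nrmN in t3.
have t4 := nrmD (f x) (- f 0); rewrite nrmN in t4.
move: mk; rewrite neq_ltn => /orP[/center_before|/center_after].
  move: (d * _)%N (d * _)%N => v u mk /andP[lo' hi'] /andP[lo hi].
  move: mk; rewrite -(ltr_nat R) natrM !natrD.
  have : k.+1%:R * nrm (f x - f 0) <= k.+1%:R *
     ((center m)%:R + u%:R + (gwid (G k))%:R + k%:R) :> R.
    rewrite ler_wpM2l//; move: hi' wW f0; rewrite natrD; lra.
  lra.
move: (d * _)%N (d * _)%N => u v km /andP[lo' hi'] /andP[lo hi].
move: km; rewrite -(ltr_nat R) natrD natrD natrM.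
have : k.+1%:R * nrm (emb R x) <= k.+1%:R * (center k + v)%:R :> R.
  by rewrite ler_wpM2l.
move: up t1 t2 lo' wW f0.
move: (k.+1%:R * (center k + v)%:R) (k.+1%:R * nrm (emb R x)) => a b; lra.
Qed.

(** If the [k]-th box is marked in the source but not in the target, then the
    target is full near the image of the box, so the map is locally onto there
    and contradicts the rigidity of the pattern. *)
Lemma rigidity : s k -> t k.
Proof.
move=> sk; apply/negPn/negP => tk.
apply: (G_rigid f_bilip (p := xshift n (center k))); split.
- by apply: pattern_set_even; rewrite mxE/= center_even.
- apply: pattern_set_even; rewrite !mxE/= oddD negb_add.
  by rewrite (negbTE (center_even k)) (negbTE (shape_even (G_shape k))).
move=> q ql qh; have qb : in_box k q by [].
split.
  split=> [sq|pq]; first exact: sq qb erefl.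
  move=> k' q' _ qb' e; have [kk qq] := box_point_inj qb qb' e.
  by rewrite -kk -!qq.
move=> sq w wW; have [y ty fy] := f_into sq.
have [|x sx fx] := f_onto (y := y + w); last by exists x; rewrite // fx embD -fy.
move=> m q' tm qb' e.
have mk : m = k.
  by apply: (image_avoids_boxes qb sq wW qb'); rewrite -e embD -fy.
by rewrite -mk tm in tk.
Qed.
End rigidity.

Definition delone_of (s : nat -> bool) : set (euclid R d) :=
  [set (emb R x : euclid R d) | x in pattern_set s].

(** A bilipschitz map has some constant and moves the origin by some amount, so
    [rigidity] applies to it in all but finitely many boxes. *)
Lemma bilipschitz_delone_of s t : bilipschitz (delone_of s) (delone_of t) ->
  exists k0, forall k, (k0 <= k)%N -> s k -> t k.
Proof.
move=> [lam lam1 [F [Finto Finj Fsurj] Flip]].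
have lam0 : 0 < lam by apply: lt_le_trans lam1.
pose f x : 'rV[R]_d := F (emb R x).
exists (maxn (Num.bound lam) (Num.bound (nrm (f 0)))) => k.
rewrite geq_max => /andP[lamk f0k].
apply: (@rigidity s t f).
- move=> x y sx sy.
  have Dx z : pattern_set s z -> delone_of s (emb R z) by exists z.
  have := Flip _ _ (Dx _ sx) (Dx _ sy); rewrite !mdistE -embB => /andP[lo hi].
  have lk : lam <= k.+1%:R.
    rewrite (le_trans (ltW (archi_boundP (ltW lam0))))// ler_nat; exact: leqW.
  split; first by rewrite (le_trans hi)// ler_wpM2r// nrm_ge0.
  move: lo; rewrite ler_pdivrMl// => /le_trans; apply.
  by rewrite ler_wpM2r// nrm_ge0.
- move=> y ty; have [|_ [x sx <-] fx] := Fsurj (emb R y); first by exists y.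
  by exists x.
- move=> x sx; have [|y ty fy] := Finto (emb R x); first by exists x.
  by exists y.
- rewrite (le_trans (ltW (archi_boundP (nrm_ge0 _))))// ler_nat//.
Qed.

(** Relatively dense because the integer points with even first coordinate are
    all present. *)
Lemma delone_delone_of s : delone (delone_of s).
Proof.
exists 2^-1, d.+1%:R; split.
- by rewrite invr_gt0.
- by rewrite (@lt_le_trans _ _ 1)// ?ler1n// invf_lt1// ltr1n.
- move=> _ _ [x sx <-] [y sy <-] xy; apply/seteqP; split=> // z [].
  rewrite !ballEmdist/= => xz yz.
  have xy1 : mdist (emb R x : euclid R d) (emb R y : euclid R d) < 1.
    rewrite (le_lt_trans (metric_triangle _ z _))// [mdist z _]metric_sym; lra.
  apply: xy; congr emb; apply/rowP => i; apply/eqP; rewrite -subr_eq0.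
  have : `|(x - y) 0 i|%:~R < 1 :> R.
    move: xy1; rewrite mdistE -embB; apply: le_lt_trans.
    have := nrm_ge_coord (emb R (x - y)) i.
    by rewrite [emb _ _ _ _]mxE -intr_norm.
  rewrite (_ : 1 = 1%:~R)// ltr_int !mxE => xy0.
  have {xy0} : `|x 0 i - y 0 i| < 1 :> int by exact: xy0.
  lia.
- apply/seteqP; split=> // z _.
  have [x xz] := emb_approx (z : 'rV[R]_d).
  pose y : Z := x + xshift n (odd (absz (x 0 ax0))).
  exists (emb R y); first exists y => //.
    by apply: pattern_set_even; rewrite !mxE; exact: even_round.
  rewrite /cball/= mdistE embD addrAC (le_trans (nrmD _ _))// nrm_xshift.
  rewrite -[d.+1]addn1 natrD lerD// ler_nat; case: odd => //.
Qed.
End family.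

(** * Cardinality *)

Section ternary.
Variable R : realType.
Implicit Types s t : nat -> bool.

(** With base 3 and the digits 0 and 1 only, the tail after a position is at most
    half the unit of that position, so distinct sequences get distinct sums. *)
Definition ternary_sum s n : R := \sum_(0 <= i < n) (s i)%:R * 3 ^- i.+1.
Definition ternary s : R := sup (range (ternary_sum s)).

Let p3 n : 3 ^- n.+1 = 3 ^- n / 3 :> R.
Proof. by rewrite exprSr invfM. Qed.

Let p3_gt0 n : 0 < 3 ^- n :> R.
Proof. by rewrite invr_gt0 exprn_gt0. Qed.

Let sumS s n : ternary_sum s n.+1 = ternary_sum s n + (s n)%:R * (3 ^- n / 3).
Proof. by rewrite /ternary_sum big_nat_recr//= p3. Qed.

Lemma ternary_sum_homo s : {homo ternary_sum s : m n / (m <= n)%N >-> m <= n}.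
Proof.
apply: homo_leq => [//|x y z|n]; first exact: le_trans.
by rewrite sumS lerDl mulr_ge0// divr_ge0// ltW.
Qed.

Let tail s n : ternary_sum s n.+1 + 3 ^- n.+1 / 2 <= ternary_sum s n + 3 ^- n / 2.
Proof.
rewrite sumS p3; have := p3_gt0 n; case: (s n) => /=; lra.
Qed.

Lemma ternary_sum_le s k n : ternary_sum s n <= ternary_sum s k + 3 ^- k / 2.
Proof.
have [nk|kn] := leqP n k.
  by rewrite (le_trans (ternary_sum_homo s nk))// lerDl divr_ge0// ltW.
have : ternary_sum s n + 3 ^- n / 2 <= ternary_sum s k + 3 ^- k / 2.
  elim: n kn => // n IH; rewrite ltnS leq_eqVlt => /orP[/eqP ->|/IH]; first exact: tail.
  exact/le_trans/tail.
have := p3_gt0 n; lra.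
Qed.

Lemma ternary_ge s n : ternary_sum s n <= ternary s.
Proof.
apply: ub_le_sup; last by exists n.
by exists (ternary_sum s 0 + 3 ^- 0 / 2) => _ [m _ <-]; exact: ternary_sum_le.
Qed.

Lemma ternary_le s n : ternary s <= ternary_sum s n + 3 ^- n / 2.
Proof.
apply: ge_sup; first by exists (ternary_sum s 0); exists 0%N.
by move=> _ [m _ <-]; exact: ternary_sum_le.
Qed.

Lemma ternary_inj : injective ternary.
Proof.
suff digit s t n : ternary s = ternary t -> ternary_sum s n = ternary_sum t n -> s n -> t n.
  move=> s t st; apply/funext => n; elim/ltn_ind: n => n IH.
  have sn : ternary_sum s n = ternary_sum t n.
    by rewrite /ternary_sum !big_nat; apply: eq_bigr => i /andP[_ /IH ->].
  by apply/idP/idP; apply: digit.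
move=> st sn ss; apply/negPn/negP => /negbTE tn.
have := ternary_ge s n.+1; have := ternary_le t n.+1.
rewrite -st !sumS p3 sn ss tn /=; have := p3_gt0 n; lra.
Qed.

Lemma card_bitseq_le_real : [set: nat -> bool] #<= [set: R].
Proof.
have := inj_card_eq (A := [set: nat -> bool]) (in2W ternary_inj).
by move=> /card_esym/card_eqPle[le _]; apply: card_le_trans le (card_leT _).
Qed.
End ternary.

Section coding.
Variables (R : realType) (d : nat).

Definition rat_point (q : 'rV[rat]_d) : 'rV[R]_d := map_mx ratr q.

Lemma rat_point_dense (x : 'rV[R]_d) (e : R) : 0 < e ->
  exists q, nrm (x - rat_point q) < e.
Proof.
move=> e0; pose c := e / d.+1%:R.
have c0 : 0 < c by rewrite divr_gt0.
have /fin_all_exists[q xq] (i : 'I_d) : exists q : rat, x 0 i < ratr q < x 0 i + c.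
  have [|q] := @rat_in_itvoo R (x 0 i) (x 0 i + c); first by rewrite ltrDl.
  by rewrite in_itv/=; exists q.
exists (\row_i q i); rewrite (@le_lt_trans _ _ (d%:R * c))//.
  apply: nrm_le_coord => i; rewrite !mxE; have := xq i; rewrite ler_norml; lra.
by rewrite /c mulrCA gtr_pMr// ltr_pdivrMr// mul1r ltr_nat.
Qed.

(** Indexed by the codes [k] of the pairs of a rational centre and of a number
    [m], standing for the radius [1 / (m + 1)]. *)
Definition meets (A : set (euclid R d)) (k : nat) : bool :=
  if unpickle k is Some (q, m) then
    `[< exists2 a, A a & nrm ((a : 'rV[R]_d) - rat_point q) < m.+1%:R^-1 >]
  else false.

Lemma delone_separated (A : set (euclid R d)) : delone A ->
  exists2 r : R, 0 < r & forall a b, A a -> A b -> mdist a b < r -> a = b.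
Proof.
move=> [r [s [r0 _ sep _]]]; exists r => // a b Aa Ab ab.
apply: contrapT => neq; have := sep a b Aa Ab neq.
move=> /seteqP[/(_ b) + _]; apply; rewrite !ballEmdist/=; split=> //.
by rewrite mdistxx.
Qed.

(** A point [a] of [A] is a limit of points of [B]; since those are uniformly
    separated, all of the close ones coincide, and [a] is one of them. *)
Lemma meets_sub (A B : set (euclid R d)) : delone B -> meets A = meets B -> A `<=` B.
Proof.
move=> /delone_separated[r r0 sep] AB a Aa.
have near (e : R) : 0 < e -> exists2 b, B b & mdist a b < e.
  move=> e0; pose m := Num.bound (2 / e).
  have me : 2 / m.+1%:R < e.
    rewrite ltr_pdivrMr// mulrC -ltr_pdivrMr//.
    by rewrite (lt_trans (archi_boundP _))// ?ltr_nat// divr_ge0// ltW.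
  have m0 : 0 < m.+1%:R^-1 :> R by rewrite invr_gt0.
  have [q aq] := rat_point_dense a m0.
  have : meets A (pickle (q, m)) by rewrite /meets pickleK; apply/asboolP; exists a.
  rewrite AB /meets pickleK => /asboolP[b Bb bq]; exists b => //.
  rewrite mdistE; move: (a : 'rV[R]_d) (b : 'rV[R]_d) aq bq => x y xq yq.
  have := nrmD (x - rat_point q) (rat_point q - y); rewrite addrA subrK.
  rewrite (nrmB (rat_point q)); move: me xq yq; move: (m.+1%:R^-1 : R) => i; lra.
have [b Bb ab] := near (r / 2) (divr_gt0 r0 (ltr0Sn _ _)).
have [->//|/eqP] := pselect (a = b); rewrite -mdist_gt0 => ab0.
have [c Bc ac] : exists2 c, B c & mdist a c < Num.min (r / 2) (mdist a b).
  by apply: near; rewrite lt_min ab0 divr_gt0.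
move: ac; rewrite lt_min => /andP[acr acb].
have bc : b = c.
  apply: sep => //; rewrite (le_lt_trans (metric_triangle _ a _))// [mdist b a]metric_sym; lra.
by rewrite bc ltxx in acb.
Qed.

Lemma card_delone_le : [set A : set (euclid R d) | delone A] #<= [set: nat -> bool].
Proof.
have inj : {in [set A : set (euclid R d) | delone A] &, injective meets}.
  move=> A B /set_mem dA /set_mem dB AB.
  by apply/seteqP; split; apply: meets_sub.
have /card_esym/card_eqPle[le _] := inj_card_eq inj.
exact: card_le_trans le (card_leT _).
Qed.
End coding.

Section lower.
Variable R : realType.

(** The Dedekind cut of [r], with each rational number tested infinitely often
    because every exponent is the 2-adic valuation of arbitrarily large numbers;
    thus the cut can be read off from any tail of the sequence. *)
Definition cut_bits (r : R) (k : nat) : bool :=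
  if unpickle (logn 2 k) is Some q then ratr q < r else false.

Lemma cut_bits_le (r r' : R) (k0 : nat) :
  (forall k, (k0 <= k)%N -> cut_bits r k -> cut_bits r' k) -> r <= r'.
Proof.
move=> H; rewrite leNgt; apply/negP => /rat_in_itvoo[q].
rewrite in_itv/= => /andP[rq qr].
pose k := (2 ^ pickle q * (2 * k0).+1)%N.
have kE : logn 2 k = pickle q.
  rewrite /k lognM ?expn_gt0// pfactorK// (@logn_coprime 2 (2 * k0).+1) ?addn0//.
  by rewrite coprime2n/= oddM.
have : cut_bits r' k.
  apply: H; last by rewrite /cut_bits kE pickleK.
  have : (0 < 2 ^ pickle q)%N by rewrite expn_gt0.
  rewrite /k; nia.
by rewrite /cut_bits kE pickleK ltNge (ltW rq).
Qed.
End lower.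

Lemma bilipschitz_refl (R : realType) (M : metricType R) (A : set M) :
  bilipschitz A A.
Proof.
exists 1%R => //; exists id.
  by split=> [x //|x y _ _ //|x Ax]; exists x.
by move=> x y _ _; rewrite invr1 !mul1r lexx.
Qed.

Lemma card_le_bilipschitz_classes (R : realType) (n : nat) :
  [set: R] #<= bilipschitz_classes (euclid R n.+2).
Proof.
have /choice[G GP] (k : nat) : exists g, good_shape n (gpat g) (glen g) (ghei g) /\
    forall A f, bilip A f k.+1 ->
    forall p, ~ @site R n A f (gwid g)%:R (gpat g) (glen g) (ghei g) p.
  have [pat [l [h [W H]]]] := @rigid_pattern R n k.+1 isT.
  by exists (Gadget pat l h W).
pose D (r : R) : set (euclid R n.+2) := delone_of G (cut_bits r).
have dD r : delone (D r) by apply: delone_delone_of => k; have [] := GP k.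
have le r r' : bilipschitz_class (D r) = bilipschitz_class (D r') -> (r' <= r)%R.
  move=> DD; have : bilipschitz_class (D r) (D r).
    by split; [exact: dD|exact: bilipschitz_refl].
  rewrite DD => -[_ /bilipschitz_delone_of H].
  have [k|k A f fL|k0] := H; [by have [] := GP k|by have [_] := GP k; apply|].
  exact: cut_bits_le.
have inj : {in [set: R] &, injective (fun r => bilipschitz_class (D r))}.
  by move=> r r' _ _ DD; apply/le_anti; rewrite !le.
have /card_esym/card_eqPle[cle _] := inj_card_eq inj.
apply: card_le_trans cle _; apply: subset_card_le => _ [r _ <-].
by exists (D r) => //; exact: dD.
Qed.

Theorem theorem2 (R : realType) (d : nat) (d_ge2 : (2 <= d)%N) :
  bilipschitz_classes (euclid R d) #= [set: R].
Proof.
apply/card_eqPle; split; last first.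
  by case: d d_ge2 => [|[|n]] // _; exact: card_le_bilipschitz_classes.
apply: card_le_trans (card_image_le _ _) _.
exact: card_le_trans (card_delone_le R d) (card_bitseq_le_real R).
Qed.
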